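(* Let $0<q<1$, $m\ge1$, and set $t=q$. For all $\vec{\mathsf{x}},\vec{\mathsf{y}}\in\mathbb{W}_m$ with $\mathsf{y}_i-\mathsf{x}_i\in\{-1,0\}$ for all $1\le i\le m$, the quantity $\Upsilon_m(\vec{\mathsf{x}},\vec{\mathsf{y}})$ at $t=q$ is equal to $$q^{-\binom m2+(m-1)(|\vec{\mathsf{x}}|-|\vec{\mathsf{y}}|)}\prod_{1\le i<j\le m}\frac{q^{\mathsf{y}_j}-q^{\mathsf{y}_i}}{q^{\mathsf{x}_j}-q^{\mathsf{x}_i}}\prod_{i=1}^m\left(q^{\mathsf{x}_i}\mathbf{1}_{\mathsf{y}_i=\mathsf{x}_i}+(1-q^{\mathsf{x}_i})\mathbf{1}_{\mathsf{y}_i=\mathsf{x}_i-1}\right).$$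
   Context: $\mathbb{W}_m$ is the set of integer vectors $\vec{\mathsf{x}}=(\mathsf{x}_1>\dots>\mathsf{x}_m\ge0)$; $|\vec{\mathsf{x}}|=\sum_i\mathsf{x}_i$; $\mathbf{1}_A$ is the indicator of the condition $A$. For $|p|<1$, $(z;p)_\infty=\prod_{i\ge 0}(1-zp^i)$, and for $0<q,t<1$ $$V_{t,q}(\vec{\mathsf{x}})=\prod_{1\le i<j\le m}\frac{\left(q^{j-i-1}t^{\mathsf{x}_i-\mathsf{x}_j-j+i+1};t\right)_\infty}{\left(q^{j-i}t^{\mathsf{x}_i-\mathsf{x}_j-j+i+1};t\right)_\infty}.$$ For $\vec{\mathsf{x}},\vec{\mathsf{y}}\in\mathbb{W}_m$ with $\mathsf{y}_i-\mathsf{x}_i\in\{-1,0\}$ for all $i$, $$\Upsilon_m(\vec{\mathsf{x}},\vec{\mathsf{y}})=t^{-\binom m2}\,\frac{V_{t,q}(\vec{\mathsf{y}})}{V_{t,q}(\vec{\mathsf{x}})}\prod_{\substack{1\le i<j\le m\\ \mathsf{y}_i=\mathsf{x}_i,\ \mathsf{y}_j=\mathsf{x}_j-1}}\frac{(1-t^{i-j+\mathsf{x}_i-\mathsf{x}_j+1}q^{j-i-1})(1-t^{i-j+\mathsf{x}_i-\mathsf{x}_j}q^{j-i+1})}{(1-t^{i-j+\mathsf{x}_i-\mathsf{x}_j+1}q^{j-i})(1-t^{i-j+\mathsf{x}_i-\mathsf{x}_j}q^{j-i})}\prod_{i:\,\mathsf{y}_i=\mathsf{x}_i}t^{\mathsf{x}_i}\prod_{i:\,\mathsf{y}_i=\mathsf{x}_i-1}\left(t^{m-i}-q^{m-i}t^{\mathsf{x}_i}\right).$$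 *)

(* Defs.v *)
From HB Require Import structures.
From mathcomp Require Import all_boot all_order all_algebra.
From mathcomp Require Import all_classical all_reals topology normedtype sequences.

Set Implicit Arguments.
Unset Strict Implicit.
Unset Printing Implicit Defensive.

Import Order.TTheory GRing.Theory Num.Theory.
Import numFieldNormedType.Exports.

Local Open Scope classical_set_scope.
Local Open Scope ring_scope.

(* Vectors are indexed from 0 by 'I_m, so the 1-based index of i : 'I_m is i.+1;
   differences of indices are unaffected. All exponents are in int, and ^ is the
   integer power exprz. *)

Definition strict_decr_nonneg (m : nat) (x : 'I_m -> int) : Prop :=
  (forall i j : 'I_m, (i < j)%N -> x j < x i) /\ (forall i : 'I_m, 0 <= x i).

Definition vsize (m : nat) (x : 'I_m -> int) : int := \sum_(i < m) x i.

(* (z; p)_oo; the limit exists when `|p| < 1. *)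
Definition qpochhammer_oo (R : realType) (z p : R) : R :=
  limn (fun n : nat => \prod_(0 <= i < n) (1 - z * p ^+ i)).

Definition Vtq (R : realType) (t q : R) (m : nat) (x : 'I_m -> int) : R :=
  \prod_(i < m) \prod_(j < m | (i < j)%N)
    (qpochhammer_oo
       (q ^ (j%:Z - i%:Z - 1) * t ^ (x i - x j - j%:Z + i%:Z + 1)) t
     / qpochhammer_oo
         (q ^ (j%:Z - i%:Z) * t ^ (x i - x j - j%:Z + i%:Z + 1)) t).

Definition Upsilon (R : realType) (t q : R) (m : nat) (x y : 'I_m -> int) : R :=
  t ^ (- ('C(m, 2))%:Z)
  * (Vtq t q y / Vtq t q x)
  * (\prod_(i < m)
     \prod_(j < m | [&& (i < j)%N, y i == x i & y j == x j - 1])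
       (((1 - t ^ (i%:Z - j%:Z + x i - x j + 1) * q ^ (j%:Z - i%:Z - 1))
         * (1 - t ^ (i%:Z - j%:Z + x i - x j) * q ^ (j%:Z - i%:Z + 1)))
        / ((1 - t ^ (i%:Z - j%:Z + x i - x j + 1) * q ^ (j%:Z - i%:Z))
           * (1 - t ^ (i%:Z - j%:Z + x i - x j) * q ^ (j%:Z - i%:Z)))))
  * (\prod_(i < m | y i == x i) t ^ (x i))
  * (\prod_(i < m | y i == x i - 1)
       (t ^ (m%:Z - i.+1%:Z) - q ^ (m%:Z - i.+1%:Z) * t ^ (x i))).

(* Main.v *)
Require Import Defs.
From mathcomp Require Import all_boot all_order all_algebra.
From mathcomp Require Import all_classical all_reals topology normedtype sequences.
From mathcomp Require Import ring lra zify.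

Import Order.TTheory GRing.Theory Num.Theory.
Import numFieldNormedType.Exports.

Local Open Scope ring_scope.

(** At [t = q] every factor of [Upsilon] telescopes or cancels.  In a factor of
    [Vtq] the powers of [t] and [q] merge, leaving
    [(q^d; q)_oo / (q^(d+1); q)_oo] with [d = x i - x j >= 1]; as
    [(z; q)_oo = (1 - z) (zq; q)_oo], this is [1 - q^d]
    ([qpochhammer_oo_ratio], [Vtq_diag]).  Dividing requires [(z; q)_oo] to be
    nonzero for [0 <= z < 1], the main analytic point
    ([qpochhammer_oo_gt0]).  In the product over mixed pairs the numerator and
    the denominator have the same two factors.

    What remains is to collect powers of [q], with indices counted from [0]
    ([one_particle_diag]).  Let [a i = x i - y i], which is
    [0] or [1].  Since [1 - q^(x i - x j) = q^(- x j) (q^(x j) - q^(x i))], the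
    quotient of the [Vtq]'s is the quotient of Vandermonde products times
    [q^(a j)] for each pair [i < j], that is, times [q^(j * a j)] for each [j].
    The one-particle factor at [i] is [q^(x i)] if [a i = 0] and
    [q^(m - 1 - i) (1 - q^(x i))] if [a i = 1].  The two exponents add up to
    [(m - 1) * a i], whence the total power [(m - 1) (|x| - |y|)]. *)

(** * The infinite q-Pochhammer symbol *)

Section QPochhammer.
Local Open Scope classical_set_scope.
Variables (R : realType) (q : R).
Hypotheses (q_gt0 : 0 < q) (q_lt1 : q < 1).

Let qpoch (z : R) (n : nat) : R := \prod_(0 <= i < n) (1 - z * q ^+ i).

Lemma qpochhammer_factor_itv (z : R) (i : nat) :
  0 <= z <= 1 -> 0 <= 1 - z * q ^+ i <= 1.
Proof.
move=> /andP[z0 z1].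
have qi0 : 0 <= q ^+ i by rewrite exprn_ge0 // ltW.
have qi1 : q ^+ i <= 1 by rewrite exprn_ile1 // ltW.
by rewrite subr_ge0 mulr_ile1 //= gerBl mulr_ge0.
Qed.

Lemma qpochhammer_itv (z : R) (n : nat) : 0 <= z <= 1 -> 0 <= qpoch z n <= 1.
Proof.
move=> hz; rewrite /qpoch; apply: (big_ind (fun p => 0 <= p <= 1)) => [||i _].
- by rewrite ler01 lexx.
- by move=> a b /andP[a0 a1] /andP[b0 b1]; rewrite mulr_ge0 //= mulr_ile1.
- exact: qpochhammer_factor_itv.
Qed.

Lemma qpochhammer_cvg (z : R) : 0 <= z <= 1 -> cvgn (qpoch z).
Proof.
move=> hz; apply: nonincreasing_is_cvgn.
- apply/nonincreasing_seqP => n; rewrite /qpoch big_nat_recr //=.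
  have /andP[p0 _] := qpochhammer_itv z n hz.
  have /andP[_ f1] := qpochhammer_factor_itv z n hz.
  exact: ler_piMr.
- exists 0 => _ [n _ <-].
  by have /andP[] := qpochhammer_itv z n hz.
Qed.

Lemma qpochhammer_oo_rec (z : R) : 0 <= z <= 1 ->
  qpochhammer_oo z q = (1 - z) * qpochhammer_oo (z * q) q.
Proof.
move=> /[dup] hz /andP[z0 z1].
have hzq : 0 <= z * q <= 1 by rewrite mulr_ge0 ?mulr_ile1 // ltW.
have shiftE : (fun n => qpoch z n.+1) = (fun n => (1 - z) * qpoch (z * q) n).
  apply/funext => n; rewrite /qpoch big_nat_recl // expr0 mulr1; congr (_ * _).
  by apply: eq_bigr => i _; rewrite exprS mulrA.
have cvgS : (fun n => (1 - z) * qpoch (z * q) n) @ \oo --> qpochhammer_oo z q.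
  by rewrite -shiftE (cvg_shiftS (qpoch z)); exact: qpochhammer_cvg.
apply: (cvg_unique _ cvgS) => //.
by apply: cvgMr; exact: qpochhammer_cvg.
Qed.

(** The Weierstrass bound [\prod (1 - a i) >= 1 - \sum a i] for the geometric
    sequence [a i = z q^i], multiplied by [1 - q]. *)
Lemma qpochhammer_lower_bound (z : R) (n : nat) : 0 <= z <= 1 ->
  1 - q - z * (1 - q ^+ n) <= (1 - q) * qpoch z n.
Proof.
move=> /[dup] hz /andP[z0 _]; elim: n => [|n IHn].
  by rewrite /qpoch big_geq // expr0 subrr mulr0 subr0 mulr1.
have /andP[_ p1] := qpochhammer_itv z n hz.
rewrite /qpoch big_nat_recr //= -/(qpoch z n).
have zqn0 : 0 <= (1 - q) * (z * q ^+ n).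
  by rewrite !mulr_ge0 ?exprn_ge0 ?subr_ge0 // ltW.
have := ler_wpM2l zqn0 p1; rewrite exprS; move: IHn; lra.
Qed.

(** The lower bound is positive only for [z < 1 - q]; a larger [z] is brought
    into that range by splitting off finitely many positive factors. *)
Lemma qpochhammer_oo_gt0 (z : R) : 0 <= z < 1 -> 0 < qpochhammer_oo z q.
Proof.
have [N hN] : exists N, q ^+ N < 1 - q.
  have /cvgrPdist_lt/(_ (1 - q)) : (GRing.exp q : R^nat) @ \oo --> (0 : R).
    by apply: cvg_expr; rewrite ger0_norm // ltW.
  rewrite subr_gt0 => /(_ q_lt1)[N _ hN]; exists N.
  by have := hN N (leqnn N); rewrite /= sub0r normrN ger0_norm // exprn_ge0 // ltW.
move=> /[dup] hz /andP[z0 z1].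
have {hN} : z * q ^+ N < 1 - q.
  by apply: le_lt_trans hN; rewrite ler_piMl ?exprn_ge0 // ltW.
elim: N z z0 z1 {hz} => [|N IHN] z z0 z1 hN.
- rewrite expr0 mulr1 in hN.
  have q1 : 0 < 1 - q by rewrite subr_gt0.
  have hz : 0 <= z <= 1 by rewrite z0 ltW.
  apply: (@lt_le_trans _ _ (1 - z / (1 - q))).
    by rewrite subr_gt0 ltr_pdivrMr // mul1r.
  apply: limr_ge; first exact: qpochhammer_cvg.
  apply: nearW => n; rewrite -(ler_pM2l q1).
  apply: le_trans (qpochhammer_lower_bound z n hz).
  rewrite mulrBr mulr1 mulrCA divff ?gt_eqF // mulr1 lerD2l lerN2.
  by rewrite ler_piMr // gerBl exprn_ge0 // ltW.
- rewrite qpochhammer_oo_rec ?z0 ?ltW // mulr_gt0 ?subr_gt0 //.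
  apply: IHN.
  + by rewrite mulr_ge0 // ltW.
  + by apply: le_lt_trans z1; rewrite ler_piMr // ltW.
  + by rewrite -mulrA -exprS.
Qed.

Lemma qpochhammer_oo_ratio (z : R) : 0 <= z < 1 ->
  qpochhammer_oo z q / qpochhammer_oo (z * q) q = 1 - z.
Proof.
move=> /andP[z0 z1]; rewrite qpochhammer_oo_rec ?z0 ?ltW // mulfK //.
rewrite gt_eqF // qpochhammer_oo_gt0 // mulr_ge0 //= 1?ltW //.
by apply: le_lt_trans z1; rewrite ler_piMr // ltW.
Qed.

End QPochhammer.

(** * Collecting powers of q *)

(** Each pair [i < j] contributes a power of [q] that only sees [j], and [j]
    has [j] predecessors. *)
Lemma prod_pairs_exprz (R : fieldType) (q : R) (m : nat) (a : 'I_m -> int) :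
  \prod_(i < m) \prod_(j < m | (i < j)%N) q ^ a j
  = \prod_(j < m) q ^ (j%:Z * a j).
Proof.
rewrite (exchange_big_dep predT) //=; apply: eq_bigr => j _.
rewrite prodr_const mulrC -exprz_exp -exprnP; congr (_ ^+ _).
transitivity #|[pred i : 'I_m | (i < j)%N]|; first exact: eq_card.
by rewrite -sum1_card -(big_ord_widen m (fun=> 1%N)) ?sum1_card ?card_ord // ltnW.
Qed.

(** A particle that jumps takes the exponent [i] from the Vandermonde quotient
    and [m - 1 - i] from its own weight, so the total does not depend on [i]. *)
Lemma one_particle_diag (R : fieldType) (q : R) (m : nat) (x y : 'I_m -> int) :
  q != 0 ->
  (forall i, y i - x i = -1 \/ y i - x i = 0) ->
  (\prod_(j < m) q ^ (j%:Z * (x j - y j)))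
  * (\prod_(i < m | y i == x i) q ^ x i)
  * (\prod_(i < m | y i == x i - 1)
       (q ^ (m%:Z - i.+1%:Z) - q ^ (m%:Z - i.+1%:Z) * q ^ x i))
  = q ^ ((m%:Z - 1) * (vsize x - vsize y))
    * \prod_(i < m) (q ^ x i * (y i == x i)%:R
                     + (1 - q ^ x i) * (y i == x i - 1)%:R).
Proof.
move=> q_neq0 hxy.
have -> : q ^ ((m%:Z - 1) * (vsize x - vsize y))
          = \prod_(i < m) q ^ ((m%:Z - 1) * (x i - y i)).
  rewrite /vsize -sumrB mulr_sumr.
  by rewrite (big_morph (fun n : int => q ^ n) (fun a b => expfzDr a b q_neq0)
                (expr0z q)).
rewrite [\prod_(i | _ == x i) _]big_mkcond [\prod_(i | _ == _ - 1) _]big_mkcond.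
rewrite -!big_split /=; apply: eq_bigr => i _.
case: (hxy i) => h.
- have -> : y i = x i - 1 by lia.
  have -> : (x i - 1 == x i) = false by lia.
  rewrite eqxx mulr0 add0r !mulr1.
  have -> : x i - (x i - 1) = 1 by ring.
  have -> : (m%:Z - 1) * 1 = i%:Z * 1 + (m%:Z - i.+1%:Z) by lia.
  by rewrite !expfzDr //; ring.
- have -> : y i = x i by lia.
  have -> : (x i == x i - 1) = false by lia.
  by rewrite eqxx subrr !mulr0 addr0 !mulr1.
Qed.

(** * The specialization t = q *)

Section Diagonal.
Variables (R : realType) (q : R).
Hypotheses (q_gt0 : 0 < q) (q_lt1 : q < 1).

Lemma exprz_lt1 (d : int) : 0 < d -> q ^ d < 1.
Proof.
case: d => [[|n]|n] // _.
by rewrite -exprnP exprn_ilt1 // ltW.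
Qed.

Lemma Vtq_diag (m : nat) (x : 'I_m -> int) : strict_decr_nonneg x ->
  Vtq q q x = \prod_(i < m) \prod_(j < m | (i < j)%N) (1 - q ^ (x i - x j)).
Proof.
have q_neq0 : q != 0 by rewrite gt_eqF.
move=> [x_decr _]; rewrite /Vtq; apply: eq_bigr => i _; apply: eq_bigr => j ij.
rewrite -!expfzDr //.
have -> : j%:Z - i%:Z - 1 + (x i - x j - j%:Z + i%:Z + 1) = x i - x j by ring.
have -> : j%:Z - i%:Z + (x i - x j - j%:Z + i%:Z + 1) = x i - x j + 1 by ring.
rewrite (expfzDr _ 1) // expr1z qpochhammer_oo_ratio //.
by rewrite exprz_ge0 1?ltW //= exprz_lt1 // subr_gt0 x_decr.
Qed.

Lemma Vtq_diag_ratio (m : nat) (x y : 'I_m -> int) :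
  strict_decr_nonneg x -> strict_decr_nonneg y ->
  Vtq q q y / Vtq q q x
  = (\prod_(i < m) \prod_(j < m | (i < j)%N)
       ((q ^ y j - q ^ y i) / (q ^ x j - q ^ x i)))
    * \prod_(j < m) q ^ (j%:Z * (x j - y j)).
Proof.
have q_neq0 : q != 0 by rewrite gt_eqF.
have vandE (u v : int) : 1 - q ^ (u - v) = (q ^ v - q ^ u) * q ^ (- v).
  by rewrite mulrBl -!expfzDr // subrr expr0z.
move=> hx hy; rewrite !Vtq_diag // -prod_pairs_exprz -prodf_div -big_split /=.
apply: eq_bigr => i _; rewrite -prodf_div -big_split /=; apply: eq_bigr => j ij.
rewrite !vandE invfM mulrACA; congr (_ * _).
by rewrite invr_expz opprK -expfzDr // addrC.
Qed.

Lemma mixed_pairs_diag (m : nat) (x y : 'I_m -> int) : strict_decr_nonneg x ->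
  \prod_(i < m)
     \prod_(j < m | [&& (i < j)%N, y i == x i & y j == x j - 1])
       (((1 - q ^ (i%:Z - j%:Z + x i - x j + 1) * q ^ (j%:Z - i%:Z - 1))
         * (1 - q ^ (i%:Z - j%:Z + x i - x j) * q ^ (j%:Z - i%:Z + 1)))
        / ((1 - q ^ (i%:Z - j%:Z + x i - x j + 1) * q ^ (j%:Z - i%:Z))
           * (1 - q ^ (i%:Z - j%:Z + x i - x j) * q ^ (j%:Z - i%:Z)))) = 1.
Proof.
have q_neq0 : q != 0 by rewrite gt_eqF.
move=> [x_decr _].
rewrite big1 // => i _; rewrite big1 // => j /and3P[ij _ _].
have d_gt0 : 0 < x i - x j by rewrite subr_gt0 x_decr.
rewrite -!expfzDr //; set d := x i - x j in d_gt0 *.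
have -> : i%:Z - j%:Z + x i - x j + 1 + (j%:Z - i%:Z - 1) = d by rewrite /d; ring.
have -> : i%:Z - j%:Z + x i - x j + (j%:Z - i%:Z + 1) = d + 1 by rewrite /d; ring.
have -> : i%:Z - j%:Z + x i - x j + 1 + (j%:Z - i%:Z) = d + 1 by rewrite /d; ring.
have -> : i%:Z - j%:Z + x i - x j + (j%:Z - i%:Z) = d by rewrite /d; ring.
rewrite [X in X / _]mulrC divff // mulf_neq0 // gt_eqF // subr_gt0 exprz_lt1 //.
by rewrite addr_gt0.
Qed.

End Diagonal.

Theorem proposition4p1 (R : realType) (q : R) (hq0 : 0 < q) (hq1 : q < 1)
    (m : nat) (hm : (1 <= m)%N) (x y : 'I_m -> int)
    (hx : strict_decr_nonneg x) (hy : strict_decr_nonneg y)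
    (hxy : forall i : 'I_m, y i - x i = -1 \/ y i - x i = 0) :
  Upsilon q q x y =
    q ^ (- ('C(m, 2))%:Z + (m%:Z - 1) * (vsize x - vsize y))
    * (\prod_(i < m) \prod_(j < m | (i < j)%N)
         ((q ^ (y j) - q ^ (y i)) / (q ^ (x j) - q ^ (x i))))
    * (\prod_(i < m)
         (q ^ (x i) * (y i == x i)%:R
          + (1 - q ^ (x i)) * (y i == x i - 1)%:R)).
Proof.
rewrite /Upsilon Vtq_diag_ratio // mixed_pairs_diag // mulr1.
set vand := \prod_(i < m) \prod_(j < m | _) _.
have := one_particle_diag R q m x y (lt0r_neq0 hq0) hxy.
rewrite expfzDr ?gt_eqF //.
set shift := \prod_(j < m) _; set stay := \prod_(i | _ == x i) _.
set jump := \prod_(i | _ == x i - 1) _; set weight := \prod_(i < m) _.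
move=> one_particle.
transitivity (q ^ (- ('C(m, 2))%:Z) * vand * (shift * stay * jump)).
  by rewrite !mulrA.
by rewrite one_particle mulrACA mulrA.
Qed.
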